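(* Let $a<b$ be real numbers and let $n$ be a positive integer. Assume that $f\in U_{n,[a,b]}$ and that $x\mapsto (f(b)-f(x))^{1/n}$ is convex on $[a,b]$. Then $$\mathbb{E}f(X)\le f\left(b-\left(\mathbb{E}(b-X)^n\right)^{1/n}\right)\le f(\mathbb{E}(X))$$ for every random variable $X$ taking values in $[a,b]$.
   Context: $C^{m}([a,b])$ is the set of $m$ times continuously differentiable functions $u:[a,b]\to\mathbb{R}$ (one-sided derivatives at the endpoints); $u^{(k)}$ is the $k$-th derivative. For a positive integer $n$ and $a<b$, $$U_{n,[a,b]} := \{u \in C^{n+1}([a,b]) : (-1)^{k}u^{(k)}(x) \le 0 \ \ \forall x\in[a,b],\ \forall k=1,\dots,n+1\}.$$ *)

(* Defs.v *)
From mathcomp Require Import all_boot all_order all_algebra.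
From mathcomp Require Import all_classical all_reals all_analysis.

Set Implicit Arguments.
Unset Strict Implicit.
Unset Printing Implicit Defensive.

Import Order.TTheory GRing.Theory Num.Theory.
Import numFieldNormedType.Exports.

Local Open Scope classical_set_scope.
Local Open Scope ring_scope.

(* A function on [a, b] is represented by a total function R -> R of which only
   the values on [a, b] matter.  Difference quotients at x are therefore taken
   along points y <> x of [a, b] only, so that the derivative is two-sided at
   interior points and one-sided at a and b.  Outside [a, b] the derivative has
   an irrelevant value. *)
Definition itv_quotient (R : realType) (a b : R) (u : R -> R) (x : R) :
    set_system R :=
  ((u y - u x) / (y - x)) @[y --> within [set` `[a, b]] x^'].

Definition itv_derivable (R : realType) (a b : R) (u : R -> R) (x : R) : Prop :=
  cvg (itv_quotient a b u x).

Definition itv_derive (R : realType) (a b : R) (u : R -> R) : R -> R :=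
  fun x => lim (itv_quotient a b u x).

Definition itv_deriven (R : realType) (a b : R) (k : nat) (u : R -> R) :
    R -> R :=
  iter k (itv_derive a b) u.

(* Continuity of the derivatives of order k < m follows from differentiability
   and is not repeated. *)
Definition Cm (R : realType) (a b : R) (m : nat) : set (R -> R) :=
  [set u |
    (forall k : nat, (k < m)%N -> forall x : R, x \in `[a, b] ->
       itv_derivable a b (itv_deriven a b k u) x) /\
    {within `[a, b], continuous (itv_deriven a b m u)}].

Definition Uclass (R : realType) (n : nat) (a b : R) : set (R -> R) :=
  [set u | Cm a b n.+1 u /\
    forall x : R, x \in `[a, b] ->
    forall k : nat, (1 <= k <= n.+1)%N ->
      (-1) ^+ k * itv_deriven a b k u x <= 0].

(* Main.v *)
(* Put H x = (f b - f x)^(1/n), so that H b = 0.  A supporting line of the convex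
   function H at x0 has nonpositive value at b, and raising it to the n-th power
   yields a pointwise bound f x <= f x0 - K ((b - x)^n - (b - x0)^n) with
   K >= 0, valid although the line may be negative.  Taking expectations gives
   E f(X) <= f x0 for all x0 > b - (E (b - X)^n)^(1/n), and x0 is sent to that
   point by continuity of f; approaching it avoids the endpoint a, where H may
   have no supporting line.  The second inequality is
   (E (b - X))^n <= E (b - X)^n together with monotonicity. *)
Require Import Defs.
From mathcomp Require Import all_boot all_order all_algebra.
From mathcomp Require Import all_classical all_reals all_analysis.
From mathcomp Require Import measurable_realfun ring lra.

Set Implicit Arguments.
Unset Strict Implicit.
Unset Printing Implicit Defensive.

Import Order.TTheory GRing.Theory Num.Theory.
Import numFieldNormedType.Exports.

Local Open Scope classical_set_scope.
Local Open Scope ring_scope.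

(** * Tangent and supporting-line inequalities *)

Lemma exprn_tangent (R : realDomainType) (n : nat) (y z : R) :
  0 <= y -> 0 <= z -> z ^+ n.+1 + n.+1%:R * z ^+ n * (y - z) <= y ^+ n.+1.
Proof.
move=> y0 z0; elim: n => [|n IHn]; first by rewrite !expr1 expr0 mulr1; lra.
(* Multiplying the induction hypothesis by [y] leaves exactly this nonnegative term as the gap to
   the next tangent. *)
have sq : 0 <= n.+1%:R * z ^+ n * (y - z) ^+ 2.
  by rewrite mulr_ge0 ?sqr_ge0// mulr_ge0 ?exprn_ge0.
have := ler_wpM2l y0 IHn.
rewrite (exprS y n.+1); apply: le_trans.
rewrite -subr_ge0; apply: le_trans sq _.
rewrite le_eqVlt; apply/orP; left; apply/eqP.
by rewrite !exprS -[n.+2%:R]natr1; ring.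
Qed.

(** Here [t] stands for the distance to [b] and [u] for the value of a convex function there;
    [u0 <= c * t0] says that the line is nonpositive at [t = 0]. *)
Lemma exprn_above_tangent (R : realFieldType) (n : nat) (c u0 t0 : R) :
  0 < u0 -> 0 < t0 -> u0 <= c * t0 ->
  exists2 K, 0 <= K & forall t u, 0 <= t -> 0 <= u ->
    u0 + c * (t - t0) <= u ->
    u0 ^+ n.+1 + K * (t ^+ n.+1 - t0 ^+ n.+1) <= u ^+ n.+1.
Proof.
move=> u00 t00 u0c.
have w0 : 0 < c * t0 by exact: lt_le_trans u0c.
have c0 : 0 < c by rewrite -(pmulr_lgt0 _ t00).
have [l [l0 l1 u0E]] : exists l, [/\ 0 <= l, 0 <= 1 - l & u0 = l * (c * t0)].
  exists (u0 / (c * t0)); split; first by rewrite divr_ge0 ?ltW.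
    by rewrite subr_ge0 ler_pdivrMr ?mul1r.
  by rewrite mulfVK ?gt_eqF.
(* Both sides must touch at [t0], so [K] is the ratio of the derivatives there,
   [c * u0 ^+ n / t0 ^+ n], rewritten with [u0 = l * (c * t0)]. *)
exists (l ^+ n * c ^+ n.+1); first by rewrite mulr_ge0 ?exprn_ge0// ltW.
move=> t u t_ge0 u_ge0; rewrite {}u0E => utan.
have ct0 : 0 <= c * t by rewrite mulr_ge0// ltW.
(* With s = c t and w = c t0, so that u0 = l w and u >= l s + (1 - l) (s - w):
   the tangent at l s bounds u^(n+1) from below, and the tangent at s bounds
   (n+1) s^n (s - w) from below by s^(n+1) - w^(n+1). *)
have h1 := exprn_tangent n u_ge0 (mulr_ge0 l0 ct0).
have h2 := exprn_tangent n (ltW w0) ct0.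
have h3 : (1 - l) * (c * t - c * t0) <= u - l * (c * t) by lra.
have k0 : 0 <= n.+1%:R * (l * (c * t)) ^+ n by rewrite mulr_ge0// exprn_ge0// mulr_ge0.
have {}h3 := ler_wpM2l k0 h3.
have k1 : 0 <= l ^+ n * (1 - l) by rewrite mulr_ge0 ?exprn_ge0.
have {}h2 := ler_wpM2l k1 h2.
apply: le_trans h1; apply: le_trans (lerD (lexx _) h3).
rewrite -subr_ge0 in h2; rewrite -subr_ge0; apply: le_trans h2 _.
rewrite le_eqVlt; apply/orP; left; apply/eqP.
by rewrite !exprS !exprMn; ring.
Qed.

(** The slope is the supremum of the chord slopes on the left of [x0]. Every chord slope on the
    right bounds them, and both sides are nonempty because [x0] is interior. *)
Lemma convex_supporting_line (R : realType) (a b x0 : R) (H : R -> R) :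
  convex_function (`[a, b]%classic : set R) H -> x0 \in `]a, b[ ->
  exists c, forall x, x \in `[a, b] -> H x0 + c * (x - x0) <= H x.
Proof.
move=> cvxH; rewrite in_itv/= => /andP[ax0 x0b].
(* Three-slope inequality: [y] is the mean of [x] and [z] with weight [(z - y) / (z - x)] on [x]. *)
have chord x y z : x \in `[a, b] -> z \in `[a, b] -> x < y -> y < z ->
    (H y - H x) / (y - x) <= (H z - H y) / (z - y).
  move=> xab zab xy yz.
  have zx : 0 < z - x by lra.
  have t0 : 0 <= (z - y) / (z - x) by apply: divr_ge0; lra.
  have t1 : (z - y) / (z - x) <= 1 by rewrite ler_pdivrMr//; lra.
  have : H ((z - y) / (z - x) * x + (1 - (z - y) / (z - x)) * z) <=
      (z - y) / (z - x) * H x + (1 - (z - y) / (z - x)) * H z.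
    exact: cvxH (Itv01 t0 t1) x z (mem_set xab) (mem_set zab).
  have -> : (z - y) / (z - x) * x + (1 - (z - y) / (z - x)) * z = y.
    by field; lra.
  have -> : (z - y) / (z - x) * H x + (1 - (z - y) / (z - x)) * H z =
            ((z - y) * H x + (y - x) * H z) / (z - x) by field; lra.
  rewrite ler_pdivlMr// => h.
  rewrite ler_pdivrMr; last lra.
  rewrite mulrAC ler_pdivlMr; last lra.
  lra.
have aab : a \in `[a, b] by rewrite in_itv/=; lra.
have bab : b \in `[a, b] by rewrite in_itv/=; lra.
pose S := [set (H x0 - H x) / (x0 - x) | x in `[a, x0[%classic].
have supS : has_sup S.
  split; first by exists ((H x0 - H a) / (x0 - a)); exists a => //=; rewrite in_itv/= lexx.
  exists ((H b - H x0) / (b - x0)) => _ [x /= xI <-].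
  move: xI; rewrite in_itv/= => /andP[ax xx0].
  by apply: chord => //; rewrite in_itv/=; lra.
exists (sup S) => x xab; have := xab; rewrite in_itv/= => /andP[ax xb].
have [xx0|x0x|->] := ltgtP x x0; last by rewrite subrr mulr0 addr0.
  have : (H x0 - H x) / (x0 - x) <= sup S.
    by apply: sup_ubound; [exact: supS.2|exists x => //=; rewrite in_itv/= ax].
  rewrite ler_pdivrMr; lra.
have : sup S <= (H x - H x0) / (x - x0).
  apply: ge_sup; first exact: supS.1.
  move=> _ [y /= yI <-].
  move: yI; rewrite in_itv/= => /andP[ay yx0].
  by apply: chord => //; rewrite in_itv/=; lra.
rewrite ler_pdivlMr; lra.
Qed.

(** * Derivatives relative to the interval *)

Section itv_derive.
Variables (R : realType) (a b : R) (u : R -> R).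

(** The increment of [u] is the difference quotient times [y - x], so it tends to 0. The quotient is
    controlled only for [y != x], hence the separate case [y = x]. *)
Lemma itv_derivable_within_cvg (x : R) :
  itv_derivable a b u x -> u @ within [set` `[a, b]] (nbhs x) --> u x.
Proof.
rewrite /itv_derivable /itv_quotient; set F := within _ _ => cvgq.
have FF : Filter F by exact: within_filter.
have xF : y - x @[y --> F] --> 0.
  rewrite -(subrr x); apply: cvgB; last exact: cvg_cst.
  by apply: cvg_trans (@nbhs_dnbhs _ x); exact: cvg_within.
have /(_ FF) := cvgM cvgq xF; rewrite mulr0 => uF.
apply/cvgrPdist_lt => e e0.
move/cvgrPdist_lt: uF => /(_ _ e0).
rewrite near_withinE => h.
have {}h : \forall y \near x, y != x -> y \in `[a, b] ->
  `|0 - (u y - u x) / (y - x) * (y - x)| < e by exact: h.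
rewrite near_withinE; near=> y => yab.
have [->|yx] := eqVneq y x; first by rewrite subrr normr0.
have : `|0 - (u y - u x) / (y - x) * (y - x)| < e.
  by move: yab; move: yx; near: y.
by rewrite sub0r mulfVK ?subr_eq0// opprB.
Unshelve. all: by end_near. Qed.

Lemma itv_derivable_within_continuous :
  {in `[a, b], forall x, itv_derivable a b u x} ->
  {within `[a, b], continuous u}.
Proof.
move=> du; apply/subspace_continuousP => x /= xab.
exact/itv_derivable_within_cvg/du.
Qed.

(** Around an interior point all nearby points lie in [[a, b]], so the restriction of the filter
    disappears. This gives access to the monotonicity criterion for ordinary derivatives. *)
Lemma is_derive_itv_derive (x : R) : x \in `]a, b[ ->
  itv_derivable a b u x -> is_derive x 1 u (itv_derive a b u x).
Proof.
move=> xab du.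
have h : h^-1 *: (u (h *: (1 : R^o) + x) - u x) @[h --> 0^'] --> itv_derive a b u x.
  have : (u (h + x) - u x) / (h + x - x) @[h --> 0^'] --> itv_derive a b u x.
    apply: (@cvg_comp _ _ _ (fun h => h + x) (fun y => (u y - u x) / (y - x)) _
      (within [set` `[a, b]] x^')); last exact: du.
    move=> P; rewrite /within/= => nP.
    have {}nP : \forall y \near x, y != x -> P y.
      near=> y => yx.
      have : y \in `]a, b[ by near: y; exact: near_in_itvoo.
      move=> /subset_itv_oo_cc; move: yx; near: y; exact: nP.
    have h0 : h + x @[h --> (0 : R)] --> x.
      by rewrite -[X in _ --> X]add0r; apply: cvgD; [exact: cvg_id|exact: cvg_cst].
    have := h0 _ nP; rewrite /= => nP0; near=> h.
    suff : h != 0 -> P (h + x) by apply; near: h; exact: nbhs_dnbhs_neq.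
    rewrite -(inj_eq (addIr x)) add0r; near: h.
    exact: nbhs_dnbhs nP0.
  by apply: cvg_trans; apply: near_eq_cvg; near=> h; rewrite addrK [_ *: 1]mulr1 mulrC.
by split; [apply/cvg_ex; exists (itv_derive a b u x)|exact/cvg_lim].
Unshelve. all: by end_near. Qed.

Lemma itv_derive_ge0_ndecr :
  {in `[a, b], forall x, itv_derivable a b u x} ->
  {in `[a, b], forall x, 0 <= itv_derive a b u x} ->
  {in `[a, b] &, {homo u : x y / x <= y}}.
Proof.
move=> du du0 x y; rewrite !in_itv/= => /andP[ax _] /andP[_ yb] xy.
have dx z : z \in `]a, b[ -> is_derive z 1 u (itv_derive a b u z).
  by move=> zab; apply: is_derive_itv_derive => //; exact/du/subset_itv_oo_cc.
apply: (@ger0_derive1_ndecr _ _ a b) => //.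
- by move=> z zab; have [] := dx z zab.
- move=> z zab; rewrite derive1E; have [_ ->] := dx z zab.
  exact/du0/subset_itv_oo_cc.
- exact: itv_derivable_within_continuous.
Qed.

End itv_derive.

(** * Expectations of bounded random variables *)

Section bounded_expectation.
Context d (T : measurableType d) (R : realType) (P : probability T R).

Lemma bounded_Lfun1 (Y : T -> R) (M : R) :
  measurable_fun setT Y -> (forall w, `|Y w| <= M) -> Y \in Lfun P 1.
Proof.
move=> mY YM; apply/Lfun1_integrable; apply: measurable_bounded_integrable => //.
  exact: fin_num_fun_lty.
by exists M; split; [exact: num_real|move=> x Mx w _; exact: le_trans (YM w) (ltW Mx)].
Qed.

(** Transfers pointwise affine inequalities to expectations as real numbers; a zero coefficient
    serves the case of a single variable. *)
Lemma expectation_affine_ge0 (Y Z : T -> R) (r k l : R) :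
  Y \in Lfun P 1 -> Z \in Lfun P 1 ->
  (forall w, 0 <= r + k * Y w + l * Z w) ->
  0 <= r + k * fine ('E_P[Y])%E + l * fine ('E_P[Z])%E.
Proof.
move=> Y1 Z1 ge0.
have kY1 : k \o* Y \in Lfun P 1 by rewrite Lfun_scale.
have lZ1 : l \o* Z \in Lfun P 1 by rewrite Lfun_scale.
have r1 : cst r \in Lfun P 1 by exact: Lfun_cst.
rewrite -lee_fin !EFinD !EFinM !fineK ?expectation_fin_num//.
rewrite -!expectationZl// -(expectation_cst P r) -!expectationD ?rpredD//.
by apply: expectation_ge0 => w /=; rewrite [Y w * _]mulrC [Z w * _]mulrC.
Qed.

End bounded_expectation.

(** * The pointwise bound and its integration *)

Lemma power_majorant (R : realType) (a b : R) (n : nat) (f : R -> R) (x0 : R) :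
  (0 < n)%N -> {in `[a, b] &, {homo f : x y / x <= y}} ->
  convex_function (`[a, b]%classic : set R)
    (fun x : R => (f b - f x) `^ (n%:R^-1)) ->
  x0 \in `]a, b[ ->
  exists2 K, 0 <= K & forall x, x \in `[a, b] ->
    f x + K * ((b - x) ^+ n - (b - x0) ^+ n) <= f x0.
Proof.
move=> n0 ndf cvxH x0ab; have x0ab' := subset_itv_oo_cc x0ab.
have := x0ab; rewrite in_itv/= => /andP[ax0 x0b].
have bab : b \in `[a, b] by rewrite in_itv/=; lra.
have fb x : x \in `[a, b] -> 0 <= f b - f x.
  by move=> xab; rewrite subr_ge0 ndf//; move: xab; rewrite in_itv/= => /andP[].
(* When [f x0] already reaches the maximum [f b], [K = 0] works; otherwise [H x0 > 0], as the
   tangent argument requires. *)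
have [fx0b|] := leP (f b) (f x0).
  exists 0 => // x /fb; rewrite mul0r; lra.
rewrite -subr_gt0 => fx0b.
have [c cH] := convex_supporting_line cvxH x0ab.
set H := fun x => (f b - f x) `^ n%:R^-1.
have Hn x : x \in `[a, b] -> H x ^+ n = f b - f x.
  move=> xab; rewrite -powR_mulrn ?powR_ge0// -powRrM mulVf ?pnatr_eq0 -?lt0n//.
  by rewrite powRr1// fb.
have Hx0 : 0 < H x0 by exact: powR_gt0.
(* The supporting line evaluated at [b], where [H] vanishes; in the variable [b - x] its slope is
   [- c]. *)
have cb : H x0 <= - c * (b - x0).
  have := cH _ bab; rewrite subrr powR0 ?invr_eq0 ?pnatr_eq0 -?lt0n// -/(H x0); lra.
have t00 : 0 < b - x0 by lra.
have [K K0 hK] := exprn_above_tangent n.-1 Hx0 t00 cb.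
rewrite prednK// in hK.
exists K => // x xab.
have bx : 0 <= b - x by move: xab; rewrite in_itv/=; lra.
have tan : H x0 + - c * (b - x - (b - x0)) <= H x.
  have := cH _ xab; rewrite -/(H x0) -/(H x); lra.
have := hK _ _ bx (powR_ge0 _ _) tan.
rewrite !Hn//; lra.
Qed.

Theorem corollary3 (R : realType) (a b : R) (hab : a < b) (n : nat)
    (hn : (0 < n)%N) (f : R -> R) (hf : Uclass n a b f)
    (hconv : convex_function (`[a, b]%classic : set R)
               (fun x : R => (f b - f x) `^ (n%:R^-1)))
    (d : measure_display) (T : measurableType d) (P : probability T R)
    (X : {RV P >-> R}) (hX : forall w : T, X w \in `[a, b]) :
  let m := fine ('E_P[fun w : T => ((b - X w) ^+ n)%R])%E in
  ('E_P[f \o X] <= (f (b - m `^ (n%:R^-1)))%:E)%E /\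
  f (b - m `^ (n%:R^-1)) <= f (fine ('E_P[X])%E).
Proof.
have [[df _] signf] := hf.
have {}df : {in `[a, b], forall x, itv_derivable a b f x}.
  by move=> x xab; exact: (df 0%N).
(* The sign condition for [k = 1] says that the first derivative is nonnegative. *)
have ndf : {in `[a, b] &, {homo f : x y / x <= y}}.
  apply: itv_derive_ge0_ndecr => // x xab.
  by have := signf x xab 1%N; rewrite expr1 mulN1r oppr_le0; apply.
have cf := itv_derivable_within_continuous df.
have Xab w : a <= X w <= b by have := hX w; rewrite in_itv.
have aab : a \in `[a, b] by rewrite in_itv/= lexx ltW.
have bab : b \in `[a, b] by rewrite in_itv/= lexx ltW.
have mX : measurable_fun setT X by exact: measurable_funPT.
have X1 : (X : T -> R) \in Lfun P 1.
  apply: (@bounded_Lfun1 _ _ _ _ _ (`|a| + `|b|)) => // w.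
  rewrite ler_norml; have := Xab w; have := ler_norm b; have := normr_ge0 a.
  have := normr_ge0 b; have := lerNnormlW (lexx `|a|); lra.
(* [f] is known to be continuous only on [[a, b]], so measurability passes through this set, which
   contains the range of [X]. *)
have mfX : measurable_fun setT (f \o X).
  apply: (@measurable_comp _ _ _ _ _ _ `[a, b]%classic) => //.
  - by move=> _ [w _ <-] /=; exact: hX.
  - exact: subspace_continuous_measurable_fun.
have fX1 : f \o X \in Lfun P 1.
  apply: (@bounded_Lfun1 _ _ _ _ _ (`|f a| + `|f b|)) => // w /=.
  have [aX Xb] := andP (Xab w).
  have faX := ndf _ _ aab (hX w) aX; have fXb := ndf _ _ (hX w) bab Xb.
  rewrite ler_norml; have := ler_norm (f b); have := lerNnormlW (lexx `|f a|).
  have := normr_ge0 (f a); have := normr_ge0 (f b); lra.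
have bX0 w : 0 <= b - X w by have := Xab w; lra.
have bXn w : (b - X w) ^+ n <= (b - a) ^+ n.
  by rewrite lerXn2r ?nnegrE//; have := Xab w; lra.
have Xn1 : (fun w => (b - X w) ^+ n) \in Lfun P 1.
  apply: (@bounded_Lfun1 _ _ _ _ _ ((b - a) ^+ n)) => [|w].
    by apply: measurable_funX; exact: measurable_funB.
  by rewrite ger0_norm ?exprn_ge0.
move=> m; set q := m `^ _; set mu := fine ('E_P[X])%E.
have m0 : 0 <= m.
  have := @expectation_affine_ge0 _ _ _ P _ _ 0 1 0 Xn1 Xn1.
  rewrite -/m => h; suff : 0 <= 0 + 1 * m + 0 * m by lra.
  by apply: h => w; have := exprn_ge0 n (bX0 w); lra.
have mba : m <= (b - a) ^+ n.
  have := @expectation_affine_ge0 _ _ _ P _ _ ((b - a) ^+ n) (- 1) 0 Xn1 Xn1.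
  rewrite -/m => h; suff : 0 <= (b - a) ^+ n + - 1 * m + 0 * m by lra.
  by apply: h => w; have := bXn w; lra.
have mua : a <= mu.
  have := @expectation_affine_ge0 _ _ _ P _ _ (- a) 1 0 X1 X1.
  rewrite -/mu => h; suff : 0 <= - a + 1 * mu + 0 * mu by lra.
  by apply: h => w; have := Xab w; lra.
have mub : mu <= b.
  have := @expectation_affine_ge0 _ _ _ P _ _ b (- 1) 0 X1 X1.
  rewrite -/mu => h; suff : 0 <= b + - 1 * mu + 0 * mu by lra.
  by apply: h => w; have := Xab w; lra.
have q0 : 0 <= q by exact: powR_ge0.
have qn : q ^+ n = m.
  by rewrite -powR_mulrn// -powRrM mulVf ?powRr1// pnatr_eq0 -lt0n.
have qba : q <= b - a.
  by rewrite -(@ler_pXn2r _ n) ?nnegrE ?qn// subr_ge0 ltW.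
(* Jensen's inequality for the [n]-th power: the tangent at [b - mu], of slope [k], is integrated
   and its linear term cancels. *)
have muq : b - mu <= q.
  rewrite -(@ler_pXn2r _ n) ?nnegrE ?subr_ge0// qn.
  have bmu : 0 <= b - mu by lra.
  pose k := n%:R * (b - mu) ^+ n.-1.
  have := @expectation_affine_ge0 _ _ _ P _ _ (- (b - mu) ^+ n - k * mu) k 1 X1 Xn1.
  rewrite -/m -/mu => h.
  suff : 0 <= - (b - mu) ^+ n - k * mu + k * mu + 1 * m by lra.
  apply: h => w; have := exprn_tangent n.-1 (bX0 w) bmu.
  rewrite prednK// -/k; lra.
have pab : b - q \in `[a, b] by rewrite in_itv/=; lra.
split; last by apply: ndf => //; [rewrite in_itv/= mua|lra].
rewrite -(fineK (expectation_fin_num fX1)) lee_fin.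
set E := fine _.
(* Integrating the majorant gives [E <= f x + K * ((b - x) ^+ n - m)], and [b - x < q] makes the
   last term nonpositive. *)
have Ele x : x \in `]a, b[ -> b - q < x -> E <= f x.
  move=> xab qx.
  have [K K0 hK] := power_majorant hn ndf hconv xab.
  have := @expectation_affine_ge0 _ _ _ P _ _ (f x + K * (b - x) ^+ n) (- 1) (- K) fX1 Xn1.
  rewrite -/m -/E => h.
  have {}h : 0 <= f x + K * (b - x) ^+ n + - 1 * E + - K * m.
    by apply: h => w; have := hK _ (hX w); rewrite /=; lra.
  have : K * (b - x) ^+ n <= K * m.
    rewrite ler_wpM2l// -qn lerXn2r ?nnegrE//; last lra.
    by move: xab; rewrite in_itv/=; lra.
  lra.
(* If [q = 0] the target point is [b], with no room to its right in the interval; there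
   [f (X w) <= f b] suffices. *)
have [q_eq0|q_neq0] := eqVneq q 0.
  rewrite q_eq0 subr0.
  have := @expectation_affine_ge0 _ _ _ P _ _ (f b) (- 1) 0 fX1 fX1.
  rewrite -/E => h; suff : 0 <= f b + - 1 * E + 0 * E by lra.
  apply: h => w /=.
  by have := ndf _ _ (hX w) bab (andP (Xab w)).2; lra.
have q_gt0 : 0 < q by rewrite lt_neqAle eq_sym q_neq0.
(* Now [b - q < b], so points [y] of []a, b[] approach [b - q] from the right, even when
   [b - q = a]. *)
apply/ler_addgt0Pr => e e0.
have /cvgrPdist_lt/(_ _ e0) := itv_derivable_within_cvg (df _ pab).
rewrite near_withinE => near_p.
near (b - q)^'+ => y.
have qy : b - q < y by near: y; exact: nbhs_right_gt.
have yb : y < b by near: y; apply: nbhs_right_lt; lra.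
have yab : y \in `]a, b[ by rewrite in_itv/=; lra.
apply: le_trans (Ele _ yab qy) _.
have : y \in `[a, b] -> `|f (b - q) - f y| < e.
  by near: y; exact: cvg_within near_p.
move=> /(_ (subset_itv_oo_cc yab)); rewrite ltr_norml; lra.
Unshelve. all: by end_near. Qed.
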